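(* There is a minimal left ideal of $(\omega^*,+)$ that is also a weak $P$-set. Consequently: (1) there is an idempotent $q\in\omega^*$ that is minimal (with respect to $\le$) and $\le_L$-maximal, i.e., there is no idempotent $p\neq q$ with $q\le_L p$; (2) there is a minimal left ideal $L\subseteq\omega^*$ such that for all $p,q\in\omega^*$, $p+q\in L$ if and only if $q\in L$; (3) there are minimal left ideals $L,L'$ of $(\omega^*,+)$ such that there is no homeomorphism $h:\omega^*\to\omega^*$ with $h(L)=L'$.
   Context: $\omega^*$ is the space of free ultrafilters on $\omega$ with basic open sets $A^*=\{p:A\in p\}$. The shift $\sigma:\omega^*\to\omega^*$ sends $p$ to the ultrafilter generated by $\{A+1:A\in p\}$. For $p\in\omega^*$ and a sequence $(x_n)$ in $\omega^*$, $r=p\text{-}\lim_n x_n$ means that for every neighbourhood $U$ of $r$, $\{n:x_n\in U\}\in p$. Addition is $p+q=p\text{-}\lim_{n}\sigma^n(q)$. A minimal left ideal is a nonempty $Y\subseteq\omega^*$ with $\omega^*+Y\subseteq Y$ (i.e., $\omega^*+Y=Y$) such that no proper nonempty subset has this property. An idempotent is $p$ with $p+p=p$; for idempotents, $p\le q$ iff $p+q=q+p=p$, and $p\le_L q$ iff $q+p=p$; an idempotent is minimal if it is $\le$-minimal among idempotents. A set $X\subseteq\omega^*$ is a weak $P$-set if the closure of every countable $D\subseteq\omega^*\setminus X$ is disjoint from $X$.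
   Formalization: In (1), p ≤_L q is taken as p+q=p (not q+p=p), and ≤_L-maximal means every idempotent p with q ≤_L p also satisfies p ≤_L q (not p=q): as printed (1) fails, since for minimal q each other minimal left ideal contains an idempotent p with p+q=q. *)

(* Defs.v *)
From HB Require Import structures.
From mathcomp Require Import all_boot.
From mathcomp Require Import all_classical topology.

Set Implicit Arguments.
Unset Strict Implicit.
Unset Printing Implicit Defensive.

Local Open Scope classical_set_scope.

Definition free_filter (T : Type) (F : set_system T) :=
  \bigcap_(A in F) A = set0.

Identity Coercion set_of_set_system : set_system >-> set.
Identity Coercion fun_of_set : set >-> Funclass.

(* The free ultrafilters on nat; the coercion makes "p A" mean "A \in p". *)
Record ostar := Ostar {
  ufilter :> set_system nat ;
  ufilter_ultra : UltraFilter ufilter ;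
  ufilter_free : free_filter ufilter }.

#[global] Existing Instance ufilter_ultra.

Lemma ostar_eq (p q : ostar) : (forall A, p A <-> q A) -> p = q.
Proof.
case: p => p pu pf; case: q => q qu qf /= pq.
have {}pq : p = q by apply/funext => A; apply/propext.
by subst q; congr Ostar; exact: Prop_irrelevance.
Qed.

Lemma ostar_setC (p : ostar) (A : set nat) : p (~` A) <-> ~ p A.
Proof.
split=> [pcA pA|npA].
  apply: (@filter_not_empty _ p _).
  by rewrite -(setICr A); exact: filterI.
by have [] := in_ultra_setVsetC A (ufilter_ultra p).
Qed.

Lemma ultra_of_setVsetC (F : set_system nat) :
  ProperFilter F -> (forall A, F A \/ F (~` A)) -> UltraFilter F.
Proof.
move=> FF FC; split=> // G GF FG; apply/seteqP; split => // A GA.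
case: (FC A) => // /FG GcA.
case: (@filter_not_empty _ G _).
by rewrite -(setICr A); exact: filterI.
Qed.

Lemma free_filterP (F : set_system nat) (FU : UltraFilter F) :
  free_filter F <-> forall n, ~ F [set n].
Proof.
split=> [F0 n Fn|Fn].
  suff : (\bigcap_(A in F) A) n by rewrite F0.
  move=> A FA; have /filter_ex [m [-> //]] : F ([set n] `&` A).
  exact: filterI.
rewrite /free_filter -subset0 => n Hn; case: (in_ultra_setVsetC [set n] FU).
  exact: Fn.
by move=> /Hn; apply.
Qed.

Lemma ostar_inhabited : exists p : ostar, True.
Proof.
have [F [FU eF]] := ultraFilterLemma eventually_filter.
suff Ff : free_filter F by exists (Ostar FU Ff).
apply/free_filterP => n Fn.
have /eF Fgt : \oo [set m | (n < m)%N] by exists n.+1.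
have /filter_ex [m [-> /=]] : F ([set n] `&` [set m | (n < m)%N]).
  exact: filterI.
by rewrite ltnn.
Qed.

HB.instance Definition _ := gen_eqMixin ostar.
HB.instance Definition _ := gen_choiceMixin ostar.
HB.instance Definition _ := isPointed.Build ostar (sval (cid ostar_inhabited)).

Definition basic (A : set nat) : set ostar := [set p | p A].

Lemma basic_cover : \bigcup_(A in [set: set nat]) basic A = setT.
Proof. by apply/seteqP; split=> // p _; exists setT => //; exact: filterT. Qed.

Lemma basic_join (A B : set nat) (p : ostar) : setT A -> setT B ->
  basic A p -> basic B p ->
  exists C, [/\ setT C, basic C p & basic C `<=` basic A `&` basic B].
Proof.
move=> _ _ pA pB; exists (A `&` B); split => //; first exact: filterI.
by move=> q qAB; split; apply: (@filterS _ q _ (A `&` B)) => // n [].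
Qed.

HB.instance Definition _ :=
  isBaseTopological.Build ostar basic_cover basic_join.

Lemma nbhs_ostarP (p : ostar) (U : set ostar) :
  nbhs p U <-> exists2 A : set nat, p A & basic A `<=` U.
Proof.
rewrite nbhsE; split=> [[V [[D' _ <-] [A D'A pA]] VU]|[A pA AU]].
  by exists A => // q qA; apply: VU; exists A.
exists (basic A) => //; split=> //; exists [set A] => //.
by rewrite bigcup_set1.
Qed.

Definition shift_filter (p : ostar) : set_system nat :=
  filter_from (ufilter p) (fun A => [set n.+1 | n in A]).

Lemma shift_filterP (p : ostar) (B : set nat) :
  shift_filter p B <-> p [set n | B n.+1].
Proof.
split=> [[A pA AB]|pB].
  by apply: filterS pA => n An; apply: AB; exists n.
by exists [set n | B n.+1] => // _ [n Bn <-].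
Qed.

Lemma shift_filter_ultra (p : ostar) : UltraFilter (shift_filter p).
Proof.
apply: ultra_of_setVsetC; last first.
  move=> A; rewrite !shift_filterP.
  exact: (in_ultra_setVsetC [set n | A n.+1] (ufilter_ultra p)).
apply: filter_from_proper; last by move=> A /filter_ex [n An]; exists n.+1, n.
apply: filter_from_filter; first by exists setT; exact: filterT.
move=> A B pA pB; exists (A `&` B); first exact: filterI.
by move=> _ [n [An Bn] <-]; split; exists n.
Qed.

Lemma shift_filter_free (p : ostar) : free_filter (shift_filter p).
Proof.
apply/(free_filterP (shift_filter_ultra p)) => m /shift_filterP pm.
have /(free_filterP (ufilter_ultra p)) pf := ufilter_free p.
by apply: (pf m.-1); apply: filterS pm => n /= <-.
Qed.

Definition shift (p : ostar) : ostar :=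
  Ostar (shift_filter_ultra p) (shift_filter_free p).

(* The p-limit of a sequence x is the limit of the image filter of p under x,
   as "x @ ufilter p --> r" unfolds to: every neighbourhood U of r satisfies
   p [set n | U (x n)]. It always exists and is unique, see plim_cvg and
   plim_unique. *)
Definition plim (p : ostar) (x : nat -> ostar) : ostar := lim (x @ ufilter p).

Definition ostar_add (p q : ostar) : ostar :=
  plim p (fun n => iter n shift q).

Declare Scope ostar_scope.
Delimit Scope ostar_scope with ostar.
Bind Scope ostar_scope with ostar.
Notation "p + q" := (ostar_add p q) : ostar_scope.
Local Open Scope ostar_scope.

Lemma ostar_hausdorff : hausdorff_space ostar.
Proof.
move=> p q pq; apply: contrapT => npq.
have [A [pA qA]] : exists A : set nat, p A /\ q (~` A).
  apply: contrapT => H; apply: npq; apply: ostar_eq => A.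
  split=> [pA|qA]; apply: contrapT => /ostar_setC nA; apply: H.
    by exists A.
  by exists (~` A); rewrite setCK.
have np : nbhs p (basic A) by apply/nbhs_ostarP; exists A.
have nq : nbhs q (basic (~` A)) by apply/nbhs_ostarP; exists (~` A).
by have [r [/= rA /ostar_setC]] := pq _ _ np nq.
Qed.

Section plim.
Variables (p : ostar) (x : nat -> ostar).

Let lim_filter : set_system nat := [set A | p [set n | x n A]].

Let lim_ultra : UltraFilter lim_filter.
Proof.
apply: ultra_of_setVsetC; last first.
  move=> A; have [|pA] := in_ultra_setVsetC [set n | x n A] (ufilter_ultra p).
    by left.
  by right; apply: filterS pA => n /= /ostar_setC.
apply: Build_ProperFilter_ex.
  move=> A; rewrite /lim_filter /= => /filter_ex [n /filter_ex [m Am]].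
  by exists m.
split.
- by rewrite /lim_filter /=; apply: filterS filterT => n _; exact: filterT.
- move=> A B pA pB; rewrite /lim_filter /=.
  apply: (@filterS _ p _ ([set n | x n A] `&` [set n | x n B])).
    by move=> n []; exact: filterI.
  exact: filterI.
- by move=> A B AB; rewrite /lim_filter /=; apply: filterS => n; exact: filterS.
Qed.

Let lim_free : free_filter lim_filter.
Proof.
apply/(free_filterP lim_ultra) => m.
rewrite /lim_filter /= => /filter_ex [n].
by have /(free_filterP (ufilter_ultra (x n))) := ufilter_free (x n); apply.
Qed.

Let plim_ex : x @ ufilter p --> Ostar lim_ultra lim_free.
Proof.
move=> U /nbhs_ostarP [A pA AU].
apply: (@filterS _ (ufilter p) _ [set n | x n A] (x @^-1` U)) => //.
by move=> n xnA; exact: AU.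
Qed.

Lemma plim_cvg : x @ ufilter p --> plim p x.
Proof. exact: cvgP plim_ex. Qed.

Lemma plim_unique (r : ostar) : x @ ufilter p --> r -> r = plim p x.
Proof. by move=> xr; apply/esym/cvg_lim => //; exact: ostar_hausdorff. Qed.

Lemma plimP (A : set nat) : plim p x A <-> p [set n | x n A].
Proof. by rewrite -(plim_unique plim_ex). Qed.

End plim.

Definition left_ideal (Y : set ostar) :=
  Y !=set0 /\ forall p q, Y q -> Y (p + q).

Definition minimal_left_ideal (Y : set ostar) :=
  left_ideal Y /\ forall Z, left_ideal Z -> Z `<=` Y -> Z = Y.

Definition ostar_idempotent (p : ostar) := p + p = p.

Definition idem_le (p q : ostar) := p + q = p /\ q + p = p.

Definition minimal_idempotent (q : ostar) :=
  ostar_idempotent q /\ forall p, ostar_idempotent p -> idem_le p q -> p = q.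

(* p is in the left ideal generated by q: this is the relation "L" for the
   convention p + q = p-lim_n shift^n q, under which left ideals Y satisfy
   ostar + Y `<=` Y. The mirror formula q + p = p is the relation for right
   ideals, which no minimal idempotent q maximizes: every minimal left ideal
   contains an idempotent p with p + q = q. *)
Definition idem_leL (p q : ostar) := p + q = p.

(* idem_leL is only a preorder (any two idempotents of a minimal left ideal are
   equivalent for it), so maximality forbids strictly larger idempotents. *)
Definition leL_maximal (q : ostar) :=
  ~ exists p, [/\ ostar_idempotent p, idem_leL q p & ~ idem_leL p q].

Definition weak_P_set (X : set ostar) :=
  forall D : set ostar, countable D -> D `<=` ~` X -> closure D `&` X = set0.

Definition homeomorphism (T U : topologicalType) (h : T -> U) :=
  continuous h /\
  exists g : U -> T, [/\ cancel h g, cancel g h & continuous g].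

(* Main.v *)
(* Call a set of naturals thick if it contains arbitrarily long intervals. A
   filter F of thick sets that is maximal among such filters is invariant
   under translations, and the closed set of ultrafilters extending F is a
   minimal left ideal. Kunen's construction of OK points is carried out
   inside the thick sets (Brian and Verner): along a well-order of the
   continuum all of whose proper initial segments are smaller than the
   continuum, starting from an independent linked family of thick sets, one
   decides every set and makes F an OK filter, each step using up only
   finitely many rows of the family. In an OK filter, each decreasing
   sequence of members has continuum many pseudo-diagonalizations V_a in F,
   of which any ultrafilter outside the closed set contains only finitely
   many; so countably many such ultrafilters all miss a common V_a, and the
   closed set is a weak P-set.
   If L is such an ideal and p + q is in L, then p + q is a limit of the
   shifts of q, so some shift of q, and hence q itself, is in L; this gives
   (2), and (1) for any idempotent of L. For (3), if q contains the set of
   powers of 2 then q lies outside of its own limit set, so a minimal left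
   ideal in this limit set is not a weak P-set. *)

Require Import Defs.
From mathcomp Require Import all_boot all_classical topology.
From mathcomp Require wochoice.

Set Implicit Arguments.
Unset Strict Implicit.
Unset Printing Implicit Defensive.

Local Open Scope classical_set_scope.
Local Open Scope ostar_scope.

(** * Sets smaller than the continuum *)

Definition column (n : nat) (x : set nat) : set nat :=
  [set m | x (pickle (n, m))].

Lemma column_onto (g : nat -> set nat) : exists x, forall n, column n x = g n.
Proof.
exists [set k | exists n m, k = pickle (n, m) /\ g n m] => n.
apply/seteqP; split=> m /=; last by move=> gnm; exists n, m.
by move=> [n' [m' [/(pcan_inj pickleK) [-> ->]]]].
Qed.

(** Cardinality below the continuum, phrased without cardinals: [S] has no surjection onto
    [set nat]. *)
Definition small (T : Type) (S : set T) :=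
  forall f : T -> set nat, ~ (forall c, (f @` S) c).

Lemma smallS (T : Type) (S S' : set T) : S `<=` S' -> small S' -> small S.
Proof.
move=> SS' sS' f fS; apply: (sS' f) => c.
by have [x Sx <-] := fS c; exists x => //; exact: SS'.
Qed.

Lemma small_image (T U : Type) (h : T -> U) (S : set T) :
  small S -> small (h @` S).
Proof.
move=> sS f fS; apply: (sS (f \o h)) => c.
by have [_ [x Sx <-] <-] := fS c; exists x.
Qed.

(* Koenig's argument: [set nat] surjects onto its countable power. *)
Lemma small_bigcup (T : Type) (S : nat -> set T) :
  (forall n, small (S n)) -> small (\bigcup_n S n).
Proof.
move=> sS f fS.
have /choice [g gP] n : exists c, ~ ((column n \o f) @` S n) c.
  by apply/existsNP; exact: sS.
have [x xg] := column_onto g.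
have [y [n _ Sny] fy] := fS x.
by apply: (gP n); exists y => //=; rewrite fy.
Qed.

Lemma small_setU (T : Type) (S S' : set T) :
  small S -> small S' -> small (S `|` S').
Proof.
move=> sS sS'; apply: (@smallS _ _ (\bigcup_n if n is 0 then S else S')).
  by move=> x [Sx|S'x]; [exists 0|exists 1].
by apply: small_bigcup => -[].
Qed.

Lemma small_subsingleton (T : Type) (S : set T) :
  (forall x y, S x -> S y -> x = y) -> small S.
Proof.
move=> S1 f fS; have [x Sx fx] := fS set0; have [y Sy fy] := fS setT.
move: fx; rewrite (S1 _ _ Sx Sy) fy => T0.
by have : (@setT nat) 0%N by []; rewrite T0.
Qed.

Lemma small_countable (T : Type) (S : set T) : countable S -> small S.
Proof.
move=> /countable_injP [f fi].
apply: (@smallS _ _ (\bigcup_n [set x | S x /\ f x = n])).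
  by move=> x Sx; exists (f x).
apply: small_bigcup => n; apply: small_subsingleton => x y [Sx fx] [Sy fy].
by apply: fi; rewrite ?inE ?fx ?fy.
Qed.

Lemma countable_sub_range (T : pointedType) (D : set T) :
  countable D -> exists h : nat -> T, D `<=` range h.
Proof.
move=> /countable_injP [f fi].
have /choice [h hP] n : exists x, (exists2 y, D y & f y = n) -> D x /\ f x = n.
  have [[y Dy fy]|N] := pselect (exists2 y, D y & f y = n); first by exists y.
  by exists point => /N.
exists h => x Dx; exists (f x) => //.
by have [|Dh fh] := hP (f x); [exists x|apply: fi; rewrite ?inE].
Qed.

(** Column 1 remains free on the fiber. The stages of the construction are indexed by [x] and treat
    [column 0 x], so every task recurs beyond any countable set of stages. *)
Lemma not_small_fiber0 (t : set nat) : ~ small [set x | column 0 x = t].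
Proof.
move/(_ (column 1)); apply => c.
have [x xP] := column_onto (fun n => if n is 0 then t else c).
by exists x => /=; rewrite xP.
Qed.

(** [R] gives every nonempty predicate a unique least element. Its order properties are read off
    from sets of two or three points, and the strict order is the negation of the reversed [R]. *)
Lemma strict_well_order (T : eqType) : exists lt : T -> T -> Prop,
  [/\ forall P : set T, P !=set0 -> exists2 z, P z & forall x, P x -> ~ lt x z,
      forall x y z, lt x y -> lt y z -> lt x z
    & forall x y, [\/ x = y, lt x y | lt y x]].
Proof.
have [R wR] := @wochoice.well_ordering_principle T.
have RP (s : seq T) x : x \in s ->
    exists z, (z \in s /\ {in s, forall y, R z y}) /\
      forall z', z' \in s -> {in s, forall y, R z' y} -> z = z'.
  move=> xs; have [|z [[zs zl] zu]] := wR (mem s); first by exists x.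
  exists z; split; first by split=> // y ys; exact: zl.
  by move=> z' z's z'l; apply: zu; split=> // y ys; exact: z'l.
have Rtot x y : R x y \/ R y x.
  have [|z [[]]] := RP [:: x; y] x; first by rewrite mem_head.
  rewrite !inE => /orP[]/eqP-> zl _; [left|right]; apply: zl;
    by rewrite !inE eqxx ?orbT.
have Rxx x : R x x by have [] := Rtot x x.
have Ranti x y : R x y -> R y x -> x = y.
  move=> xy yx; have [|z [_ zu]] := RP [:: x; y] x; first by rewrite mem_head.
  have zx : z = x by apply: zu => [|w]; rewrite !inE ?eqxx // => /orP[]/eqP->.
  have zy : z = y.
    by apply: zu => [|w]; rewrite !inE ?eqxx ?orbT // => /orP[]/eqP->.
  by rewrite -zx zy.
exists (fun x y => ~ R y x); split.
- move=> P [x Px]; have [|z [[zP zl] _]] := wR [pred x | `[< P x >]].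
    by exists x; apply/asboolP.
  exists z; first exact/asboolP.
  by move=> y Py; apply; apply: zl; apply/asboolP.
- move=> x y z nyx nzy zx.
  have [|w [[]]] := RP [:: x; y; z] x; first by rewrite mem_head.
  rewrite !inE => /or3P[]/eqP-> wl _.
  + have xz : R x z by apply: wl; rewrite !inE eqxx !orbT.
    have E := Ranti _ _ xz zx; rewrite -E in nzy.
    by case: (Rtot x y).
  + by apply: nyx; apply: wl; rewrite !inE eqxx.
  + by apply: nzy; apply: wl; rewrite !inE eqxx !orbT.
- move=> x y; have [xy|] := pselect (R x y); last by move=> nxy; apply: Or33.
  have [yx|nyx] := pselect (R y x); first exact/Or31/Ranti.
  exact: Or32.
Qed.

(* If some proper initial segment of a well-order is not small, the least such
   segment surjects onto [set nat]; pull its order back along a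
   choice of preimages. *)
Lemma small_well_order : exists lt : set nat -> set nat -> Prop,
  [/\ well_founded lt, forall x y z, lt x y -> lt y z -> lt x z,
      forall x y, [\/ x = y, lt x y | lt y x]
    & forall x, small [set y | lt y x]].
Proof.
suff [lt [ltmin lttr lttot ltS]] : exists lt : set nat -> set nat -> Prop,
  [/\ forall P : set (set nat), P !=set0 ->
        exists2 z, P z & forall x, P x -> ~ lt x z,
      forall x y z, lt x y -> lt y z -> lt x z,
      forall x y, [\/ x = y, lt x y | lt y x]
    & forall x, small [set y | lt y x]].
  exists lt; split; [|exact: lttr|exact: lttot|exact: ltS] => x.
  apply: contrapT => nx.
  have [|z nz zmin] := ltmin (fun z => ~ Acc lt z); first by exists x.
  by apply: nz; split=> y yz; apply: contrapT => /zmin.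
have [lt [ltmin lttr lttot]] := strict_well_order (set nat).
have [ltS|/existsNP nS] := pselect (forall x, small [set y | lt y x]).
  by exists lt.
have [x /existsNP [f /contrapT fx] xmin] := ltmin _ nS.
have /choice [g gP] c : exists y, lt y x /\ f y = c.
  by have [y yx fy] := fx c; exists y.
exists (fun a b => lt (g a) (g b)); split.
- move=> P [c Pc]; have [|z [d Pd <-] zmin] := ltmin (g @` P).
    by exists (g c), c.
  by exists d => // e Pe; apply: zmin; exists e.
- by move=> a b c; exact: lttr.
- move=> a b; have [E|ab|ba] := lttot (g a) (g b).
  + by apply: Or31; rewrite -(gP a).2 -(gP b).2 E.
  + exact: Or32.
  + exact: Or33.
- move=> b; apply: (@smallS _ _ (f @` [set y | lt y (g b)])).
    by move=> a ab; exists (g a) => //; exact: (gP a).2.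
  apply: small_image; apply: contrapT => nb.
  exact: (xmin (g b) nb (gP b).1).
Qed.

(** * Thick sets and independent linked families *)

Definition thick (A : set nat) :=
  forall k, exists m, forall i, (i < k)%N -> A (m + i)%N.

Lemma thickS (A B : set nat) : A `<=` B -> thick A -> thick B.
Proof. by move=> AB tA k; have [m mA] := tA k; exists m => i /mA /AB. Qed.

Lemma thick_ge (N : nat) (A : set nat) :
  thick A -> thick (A `&` [set m | (N <= m)%N]).
Proof.
move=> tA k; have [m mA] := tA (N + k)%N; exists (m + N)%N => i ik.
split=> /=; last by rewrite addnAC leq_addl.
by rewrite -addnA; apply: mA; rewrite ltn_add2l.
Qed.

(* The triple [(i, (n, t))] stands for the intersection of the [A i a n] with
   [a] in [t]. *)
Definition requirement : Type := (set nat * (nat * seq (set nat)))%type.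

Definition requirement_set (A : set nat -> set nat -> nat -> set nat)
    (c : seq requirement) : set nat :=
  [set m | forall e, e \in c -> forall a, a \in e.2.2 -> A e.1 a e.2.1 m].

(** At level [n] of a row at most [n] sets may be required at once, because more than [n] of them
    have a finite intersection. *)
Definition admissible (c : seq requirement) :=
  {in c &, forall e e', e.1 = e'.1 -> e = e'} /\
  {in c, forall e, (size e.2.2 <= e.2.1)%N}.

Definition trace (k : nat) (x : set nat) : {set 'I_k} :=
  finset (fun i : 'I_k => `[< x i >]).

Lemma trace_separates (s : seq (set nat)) :
  exists K, forall k, (K <= k)%N -> {in s &, injective (trace k)}.
Proof.
have /choice [d dP] (xy : set nat * set nat) : exists K,
    forall k, (K <= k)%N -> trace k xy.1 = trace k xy.2 -> xy.1 = xy.2.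
  case: xy => x y /=; have [->|xy] := pselect (x = y); first by exists 0.
  have [m mxy] : exists m, ~ (x m <-> y m).
    apply/existsNP => xy'; apply: xy; apply/funext => m.
    exact/propext/xy'.
  exists m.+1 => k mk /setP /(_ (Ordinal mk)); rewrite !inE /= => E.
  by case: mxy; split=> /asboolP; [rewrite E|rewrite -E] => /asboolP.
exists (\max_(x <- s) \max_(y <- s) d (x, y)) => k Kk x y xs ys.
apply: (dP (x, y)); apply: leq_trans Kk.
apply: (@leq_trans (\max_(y <- s) d (x, y))).
  exact: (@leq_bigmax_seq _ s predT (fun y => d (x, y)) y ys isT).
exact: (@leq_bigmax_seq _ s predT (fun x => \max_(y <- s) d (x, y)) x xs isT).
Qed.

Lemma unbounded_of_injective (h : nat -> nat) : injective h ->
  forall K L, exists2 k, (K <= k)%N & (L <= h k)%N.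
Proof.
move=> hi K L; apply: contrapT => H.
suff : (size (map h (iota K L.+1)) <= size (iota 0 L))%N.
  by rewrite size_map !size_iota ltnn.
apply: uniq_leq_size; first by rewrite map_inj_uniq ?iota_uniq.
move=> _ /mapP[k + ->]; rewrite !mem_iota /= => /andP[Kk _].
by rewrite ltnNge; apply/negP => Lk; apply: H; exists k.
Qed.

(* Kunen's family lives on the countable set of pairs [(k, f)] with
   [f : P(k) -> P(P(k))]; each such pair is blown up here to a dyadic interval,
   so that infinite sets become thick and finite sets stay finite. *)
Lemma independent_linked_family :
  exists A : set nat -> set nat -> nat -> set nat,
  [/\ forall i a n n', (n <= n')%N -> A i a n `<=` A i a n',
      forall i n t, uniq t -> (n < size t)%N ->
        exists N, forall m, (forall a, a \in t -> A i a n m) -> (m < N)%N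
    & forall c, admissible c -> thick (requirement_set A c)].
Proof.
pose X := {k : nat & {ffun {set 'I_k} -> {set {set 'I_k}}}}.
(* With the point read as [(k, f)], [S] is the value of [f] at the trace of [i]. *)
pose E (i a : set nat) (n : nat) (x : X) :=
  let S := tagged x (trace (tag x) i) in
  (#|S| <= n)%N && (trace (tag x) a \in S).
exists (fun i a n => [set m | exists x : X,
  pickle x = trunc_log 2 m /\ E i a n x]); split.
- move=> i a n n' nn' m [x [xm /andP[Sn Sa]]]; exists x; split=> //.
  by rewrite /E Sa (leq_trans Sn).
- move=> i n t tu nt; have [K Kt] := trace_separates t.
  (* From [K] on, the sets in [t] have more than [n] distinct traces, too many for [S]. Only the
     finitely many points with [k < K] remain, and [N] bounds their codes. *)
  pose F k (f : {ffun {set 'I_k} -> {set {set 'I_k}}}) :=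
    pickle (Tagged (fun k => {ffun {set 'I_k} -> {set {set 'I_k}}}) f).
  pose N := \max_(k < K) \max_f F k f.
  exists (2 ^ N.+1) => m mt.
  have [a0 a0t] : exists a0, a0 \in t.
    by case: t nt {tu Kt mt} => // a0 t _; exists a0; rewrite mem_head.
  have [x [xm /andP[Sn _]]] := mt _ a0t.
  have [Kx|xK] := leqP K (tag x).
    suff : (size t <= n)%N by rewrite leqNgt nt.
    apply: leq_trans Sn; rewrite -(size_map (trace (tag x))) cardE.
    apply: uniq_leq_size; first by rewrite map_inj_in_uniq //; exact: Kt.
    move=> _ /mapP[a at_ ->]; rewrite mem_enum.
    have [y [ym /andP[_]]] := mt _ at_.
    by rewrite -(pcan_inj pickleK (etrans xm (esym ym))).
  have xN : (pickle x <= N)%N.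
    case: x xK {xm Sn} => k f /= kK.
    apply: leq_trans (@leq_bigmax _ (fun k : 'I_K => \max_f F k f)
      (Ordinal kK)).
    exact: (@leq_bigmax _ (F k) f).
  have [->|m0] := posnP m; first by rewrite expn_gt0.
  apply: leq_trans (trunc_log_ltn m (isT : (1 < 2)%N)) _.
  by rewrite leq_exp2l // ltnS -xm.
- move=> c [cu cs] L; have [K Kc] := trace_separates (map fst c).
  (* The witness [f] maps the trace of each row index in [c] to the traces of the sets required
     there, unambiguously once [k] separates these indices. Other arguments of [f] get the empty
     requirement [d]. *)
  pose d : requirement := (set0, (0%N, [::])).
  pose e0 k S := nth d c (find (fun e => trace k e.1 == S) c).
  pose x k : X := Tagged (fun k => {ffun {set 'I_k} -> {set {set 'I_k}}})
    [ffun S => finset (fun y => y \in map (trace k) (e0 k S).2.2)].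
  have xi : injective (pickle \o x).
    by move=> k k' /(pcan_inj pickleK) /(congr1 tag).
  (* A code of at least [L] makes its dyadic interval longer than [L]. *)
  have [k Kk Lk] := unbounded_of_injective xi K L.
  exists (2 ^ pickle (x k)) => l lL e ec a ae; exists (x k); split.
    apply/esym/trunc_log_eq => //; rewrite leq_addr /=.
    rewrite expnS mul2n -addnn ltn_add2l.
    apply: leq_trans lL (leq_trans Lk _).
    exact/ltnW/ltn_expl.
  have ee : e0 k (trace k e.1) = e.
    have he : has (fun e' => trace k e'.1 == trace k e.1) c.
      by apply/hasP; exists e.
    apply: cu => //; first by rewrite mem_nth // -has_find.
    apply: (Kc k) => //; last exact/eqP/(nth_find d he).
      by apply: map_f; rewrite mem_nth // -has_find.
    exact: map_f.
  rewrite /E /= ffunE ee inE map_f // andbT cardsE.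
  apply: leq_trans (card_size _) _; rewrite size_map; exact: cs.
Qed.

(** * The transfinite construction *)

(** Weaker than the dichotomy of an ultrafilter: the alternative to membership is that adjoining [B]
    would destroy thickness. *)
Definition decided (F : set_system nat) (B : set nat) :=
  F B \/ exists2 W, F W & ~ thick (W `&` B).

Definition maximal_thick_filter (F : set_system nat) :=
  [/\ Filter F, forall U, F U -> thick U & forall B, decided F B].

(* Kunen's OK property, with [set nat] as index set. *)
Definition OK_for (F : set_system nat) (U : nat -> set nat) :=
  exists2 V : set nat -> set nat, forall a, F (V a) &
    forall t, uniq t -> exists N, forall m, (N <= m)%N ->
      (forall a, a \in t -> V a m) -> forall k, (k < size t)%N -> U k m.

Definition OK_filter (F : set_system nat) :=
  forall U, (forall n, F (U n)) -> OK_for F U.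

Lemma decidedS (F F' : set_system nat) B :
  F `<=` F' -> decided F B -> decided F' B.
Proof.
by move=> FF' [FB|[W FW nW]]; [left|right; exists W => //]; exact: FF'.
Qed.

Lemma OK_forS (F F' : set_system nat) U :
  F `<=` F' -> OK_for F U -> OK_for F' U.
Proof. by move=> FF' [V FV VP]; exists V => // a; exact: FF'. Qed.

Lemma admissible_cons (c : seq requirement) i n t :
  admissible c -> {in c, forall e, e.1 <> i} -> (size t <= n)%N ->
  admissible ((i, (n, t)) :: c).
Proof.
move=> [cu cs] ci tn; split=> [e e'|e]; rewrite ?inE.
  move=> /orP[/eqP->|ec] /orP[/eqP->|e'c] //=; last exact: cu.
    by move=> E; case: (ci _ e'c).
  by move=> /= E; case: (ci _ ec).
by case/orP => [/eqP->//|]; exact: cs.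
Qed.

Lemma admissible_cat (c c' : seq requirement) :
  admissible c -> admissible c' ->
  (forall e e', e \in c -> e' \in c' -> e.1 <> e'.1) -> admissible (c ++ c').
Proof.
move=> [cu cs] [cu' cs'] cc'; split=> [e e'|e]; rewrite !mem_cat.
  move=> /orP[ec|ec'] /orP[e'c|e'c'] E; [exact: cu| | |exact: cu'].
    by case: (cc' _ _ ec e'c').
  by case: (cc' _ _ e'c ec').
by case/orP; [exact: cs|exact: cs'].
Qed.

Section construction.
Variable A : set nat -> set nat -> nat -> set nat.
Hypothesis A_mono : forall i a n n', (n <= n')%N -> A i a n `<=` A i a n'.
Hypothesis A_linked : forall i n t, uniq t -> (n < size t)%N ->
  exists N, forall m, (forall a, a \in t -> A i a n m) -> (m < N)%N.
Hypothesis A_indep : forall c, admissible c -> thick (requirement_set A c).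

(* A filter together with the set of indices of rows of [A] already used. *)
Definition state : Type := (set_system nat * set (set nat))%type.

Definition avoids (c : seq requirement) (K : set (set nat)) :=
  {in c, forall e, ~ K e.1}.

Definition consistent (s : state) := Filter s.1 /\
  forall U c, s.1 U -> admissible c -> avoids c s.2 ->
    thick (U `&` requirement_set A c).

Definition extends (s s' : state) :=
  [/\ s.1 `<=` s'.1, s.2 `<=` s'.2, consistent s' & finite_set (s'.2 `\` s.2)].

Lemma extends_trans s1 s2 s3 :
  extends s1 s2 -> extends s2 s3 -> extends s1 s3.
Proof.
move=> [F12 K12 _ D12] [F23 K23 s3C D23]; split=> //.
- exact: subset_trans F12 F23.
- exact: subset_trans K12 K23.
- apply: (@sub_finite_set _ _ ((s2.2 `\` s1.2) `|` (s3.2 `\` s2.2))).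
    move=> i [i3 i1].
    by have [i2|i2] := pselect (s2.2 i); [left|right].
  by rewrite finite_setU.
Qed.

Definition adjoin (F : set_system nat) (B : set nat) : set_system nat :=
  [set X | exists2 U, F U & U `&` B `<=` X].

Lemma adjoin_filter F B : Filter F -> Filter (adjoin F B).
Proof.
move=> FF; split.
- by exists setT => //; exact: filterT.
- move=> X Y [U FU UX] [W FW WY]; exists (U `&` W); first exact: filterI.
  by move=> m [[Um Wm] Bm]; split; [exact: UX|exact: WY].
- by move=> X Y XY [U FU UX]; exists U => //; exact: subset_trans UX XY.
Qed.

Lemma sub_adjoin F B : F `<=` adjoin F B.
Proof. by move=> U FU; exists U => // m []. Qed.

Lemma adjoin_mem F B : Filter F -> adjoin F B B.
Proof. by move=> FF; exists setT; [exact: filterT|move=> m []]. Qed.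

Lemma extend_decided s B : consistent s ->
  exists s', extends s s' /\ decided s'.1 B.
Proof.
move=> [FF sI].
have [BI|] := pselect (forall U c, s.1 U -> admissible c -> avoids c s.2 ->
    thick (U `&` B `&` requirement_set A c)).
  exists (adjoin s.1 B, s.2); split; last exact/or_introl/adjoin_mem.
  split=> //=; [exact: sub_adjoin| |by rewrite setDv; exact: finite_set0].
  split; first exact: adjoin_filter.
  move=> X c [U sU UX] ca cK; apply: thickS (BI U c sU ca cK).
  by move=> m [Um cm]; split=> //; exact: UX.
move=> /existsNP[U0 /existsNP[c0 /not_implyP[sU0 /not_implyP[c0a]]]].
move=> /not_implyP[c0K nthick].
exists (adjoin s.1 (requirement_set A c0), s.2 `|` [set e.1 | e in [set` c0]]).
split; last first.
  right; exists (U0 `&` requirement_set A c0); first by exists U0.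
  by apply: contra_not nthick; apply: thickS => m [[]].
split=> /=; [exact: sub_adjoin|by left| |].
- split; first exact: adjoin_filter.
  move=> X c [U sU UX] ca cK.
  apply: (@thickS (U `&` requirement_set A (c0 ++ c))).
    move=> m [Um cm]; split; first (apply: UX; split=> //).
      by move=> e ec0; apply: cm; rewrite mem_cat ec0.
    by move=> e ec; apply: cm; rewrite mem_cat ec orbT.
  apply: sI => //.
    apply: admissible_cat => // e e' ec0 e'c E.
    by apply: (cK _ e'c); right; exists e.
  move=> e; rewrite mem_cat => /orP[|ec]; first exact: c0K.
  by move=> se; apply: (cK _ ec); left.
- apply: (@sub_finite_set _ _ [set e.1 | e in [set` c0]]) => [i [[]]//|].
  exact/finite_image/finite_seq.
Qed.

Lemma extend_OK s U i : consistent s -> ~ s.2 i -> (forall n, s.1 (U n)) ->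
  exists s', extends s s' /\ OK_for s'.1 U.
Proof.
move=> [FF sI] si sU.
pose U' n : set nat := [set m | forall k, (k < n)%N -> U k m].
have sU' n : s.1 (U' n).
  elim: n => [|n IH]; first by apply: filterS filterT => m _ k.
  apply: filterS (filterI IH (sU n)) => m [mn Um] k.
  by rewrite ltnS leq_eqVlt => /orP[/eqP->//|]; exact: mn.
pose V a : set nat := [set m | exists2 n, U' n m & A i a n m].
pose VI (t : seq (set nat)) : set nat := [set m | forall a, a \in t -> V a m].
exists ([set X | exists2 W, s.1 W & exists t, W `&` VI t `<=` X],
  s.2 `|` [set i]); split; last first.
  exists V => /= [a|t tu].
    exists setT; first exact: filterT.
    by exists [:: a] => m [_]; apply; rewrite mem_head.
  case: t tu => [|a0 t'] tu; first by exists 0.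
  set t := a0 :: t' in tu *.
  (* From [N] on, [m] cannot lie in level [size t - 1] of row [i] for all [a] in [t]. So some [a]
     has [m] in [V a] through a level [n] of at least [size t], and [U' n] supplies every required
     [U k]. *)
  have [N NP] := A_linked i tu (leqnn (size t)).
  exists N => m Nm mt k kt.
  have [[a at_ [n Un An]]|H] := pselect
      (exists2 a, a \in t & exists2 n, U' n m & (size t <= n)%N).
    by apply: Un; exact: leq_trans An.
  suff : (m < N)%N by rewrite ltnNge Nm.
  apply: NP => a at_; have [n Un An] := mt _ at_.
  apply: (A_mono _ An); rewrite -ltnS ltnNge; apply/negP => tn.
  by apply: H; exists a => //; exists n.
split=> /=; [|by left| |].
- by move=> X sX; exists X => //; exists [::] => m [].
- split; first split=> /=.
  + by exists setT; [exact: filterT|exists [::]].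
  + move=> X Y [W sW [t WX]] [W' sW' [t' WY]].
    exists (W `&` W'); first exact: filterI.
    exists (t ++ t') => m [[Wm W'm] mt]; split.
      by apply: WX; split=> // a at_; apply: mt; rewrite mem_cat at_.
    by apply: WY; split=> // a at_; apply: mt; rewrite mem_cat at_ orbT.
  + move=> X Y XY [W sW [t WX]]; exists W => //; exists t.
    exact: subset_trans WX XY.
  move=> X c [W sW [t WX]] ca cK.
  pose c' := (i, (size t, t)) :: c.
  apply: (@thickS (W `&` U' (size t) `&` requirement_set A c')).
    move=> m [[Wm Um] cm]; split; last first.
      by move=> e ec; apply: cm; rewrite inE ec orbT.
    apply: WX; split=> // a at_; exists (size t) => //.
    by apply: (cm (i, (size t, t))) => //; rewrite mem_head.
  apply: sI; first exact: filterI.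
    apply: admissible_cons => // e ec ei.
    by apply: (cK _ ec); right.
  move=> e; rewrite inE => /orP[/eqP->//|ec] se.
  by apply: (cK _ ec); left.
- by apply: (@sub_finite_set _ _ [set i]) => // j [[]].
Qed.

Definition treats (t : set nat) (s s' : state) := [/\ extends s s',
  decided s'.1 t & (forall n, s.1 (column n t)) -> OK_for s'.1 (column^~ t)].

Lemma extend_treats t s : consistent s -> small s.2 ->
  exists s', treats t s s'.
Proof.
move=> sC sS.
have [i si] : exists i, ~ s.2 i.
  apply/existsNP => H; apply: (sS id) => c; exists c => //; exact: H.
have [sU|nU] := pselect (forall n, s.1 (column n t)).
  have [s1 [e1 ok1]] := extend_OK sC si sU.
  have [_ _ s1C _] := e1; have [s2 [e2 d2]] := extend_decided t s1C.
  exists s2; split=> //; first exact: extends_trans e2.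
  by move=> _; apply: OK_forS ok1; case: e2.
by have [s2 [e2 d2]] := extend_decided t sC; exists s2; split.
Qed.

(** * Iteration along a well-order of the continuum *)

Variable lt : set nat -> set nat -> Prop.
Hypothesis lt_wf : well_founded lt.
Hypothesis lt_trans : forall x y z, lt x y -> lt y z -> lt x z.
Hypothesis lt_total : forall x y, [\/ x = y, lt x y | lt y x].
Hypothesis lt_small : forall x, small [set y | lt y x].

(** The cofinite filter [\oo] is included so that the least stage also starts from a filter. *)
Definition before (G : set nat -> state) (x : set nat) : state :=
  ([set U | \oo U \/ exists2 y, lt y x & (G y).1 U],
   [set i | exists2 y, lt y x & (G y).2 i]).

Lemma transfinite_recursion (step : set nat -> state -> state) :
  exists G, forall x, G x = step x (before G x).
Proof.
pose b x (g : forall y, lt y x -> state) : state :=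
  ([set U | \oo U \/ exists y (h : lt y x), (g y h).1 U],
   [set i | exists y (h : lt y x), (g y h).2 i]).
pose G := Fix lt_wf (fun=> state) (fun x g => step x (b x g)).
exists G => x; rewrite {1}/G Fix_eq; last first.
  move=> y f g fg; congr (step y (b y _)).
  by apply/functional_extensionality_dep => z;
    apply/functional_extensionality_dep => h.
congr (step x (_, _)); apply/seteqP; split=> U /=.
- by move=> [?|[y [yx ?]]]; [left|right; exists y].
- by move=> [?|[y yx ?]]; [left|right; exists y, yx].
- by move=> [y [yx ?]]; exists y.
- by move=> [y yx ?]; exists y, yx.
Qed.

Lemma treating_sequence :
  exists G, forall x, treats (column 0 x) (before G x) (G x).
Proof.
have /choice [step stepP] (ts : set nat * state) : exists s',
    consistent ts.2 -> small ts.2.2 -> treats ts.1 ts.2 s'.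
  have [[C S]|N] := pselect (consistent ts.2 /\ small ts.2.2).
    by have [s' s'P] := extend_treats ts.1 C S; exists s'.
  by exists ts.2 => C S; case: N.
have [G GE] := transfinite_recursion (fun x s => step (column 0 x, s)).
exists G; apply: (well_founded_ind lt_wf) => x IH.
have GF y z : lt y z -> lt z x -> (G y).1 `<=` (G z).1.
  move=> yz zx U GU; have [[+ _ _ _] _ _] := IH z zx; apply.
  by right; exists y.
have Goo y U : lt y x -> \oo U -> (G y).1 U.
  by move=> yx ooU; have [[+ _ _ _] _ _] := IH y yx; apply; left.
have GFilter y : lt y x -> Filter (G y).1.
  by move=> yx; have [[_ _ []]] := IH y yx.
rewrite GE; apply: (stepP (column 0 x, before G x)) => /=;
  [split; first split=> /=|].
- by left; exact: filterT.
- move=> U W [ooU|[y yx GU]] [ooW|[z zx GW]].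
  + by left; exact: filterI.
  + right; exists z => //; have := GFilter z zx => ?.
    by apply: filterI => //; exact: Goo.
  + right; exists y => //; have := GFilter y yx => ?.
    by apply: filterI => //; exact: Goo.
  + right; have := GFilter y yx => ?; have := GFilter z zx => ?.
    have [E|yz|zy] := lt_total y z.
    * by exists y => //; apply: filterI => //; rewrite E.
    * by exists z => //; apply: filterI => //; exact: GF GU.
    * by exists y => //; apply: filterI => //; exact: GF GW.
- move=> U W UW [ooU|[y yx GU]]; first by left; exact: filterS ooU.
  by right; exists y => //; have := GFilter y yx => ?; exact: filterS GU.
- move=> U c [[N _ NU]|[y yx GU]] ca cK.
    apply: thickS (thick_ge N (A_indep ca)) => m [cm Nm]; split=> //.
    exact: NU.
  have [[_ _ [_ yI] _] _ _] := IH y yx; apply: yI => //.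
  by move=> e ec Ge; apply: (cK _ ec); exists y.
(* Each earlier stage uses finitely many new rows, so the rows used before [x] are covered by
   countably many images of a small initial segment. *)
- have /choice [h hP] y : exists h : nat -> set nat, lt y x ->
      (G y).2 `\` (before G y).2 `<=` range h.
    have [yx|] := pselect (lt y x); last by exists (fun=> point).
    have [[_ _ _ D] _ _] := IH y yx.
    by have [h hP] := countable_sub_range (finite_set_countable D); exists h.
  apply: (@smallS _ _ (\bigcup_n (h^~ n @` [set y | lt y x]))).
    move=> i [y]; elim/(well_founded_ind lt_wf): y => y IHy yx Gi.
    have [[z zy Gz]|N] := pselect ((before G y).2 i).
      by apply: (IHy z) => //; exact: lt_trans yx.
    by have [|n _ hn] := hP y yx i; [split|exists n => //; exists y].
  by apply: small_bigcup => n; apply: small_image.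
Qed.

Lemma OK_filter_of_family : exists2 F, maximal_thick_filter F & OK_filter F.
Proof.
have [G GP] := treating_sequence.
have GF y z : lt y z -> (G y).1 `<=` (G z).1.
  move=> yz U GU; have [[+ _ _ _] _ _] := GP z; apply.
  by right; exists y.
have GC y : consistent (G y) by have [[]] := GP y.
have GFilter y : Filter (G y).1 by have [] := GC y.
pose F : set_system nat := [set U | exists x, (G x).1 U].
have FG x : (G x).1 `<=` F by move=> U GU; exists x.
exists F; first split.
- split=> [|U W [y GU] [z GW]|U W UW [y GU]].
  + by exists point; exact: filterT.
  + have [E|yz|zy] := lt_total y z.
    * by exists y; apply: filterI => //; rewrite E.
    * by exists z; apply: filterI => //; exact: GF GU.
    * by exists y; apply: filterI => //; exact: GF GW.
  + by exists y; exact: filterS GU.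
- move=> U [y GU]; have [_ yI] := GC y.
  by apply: thickS (yI U [::] GU _ _) => [m []|//|//].
- move=> B; have [x xB] := column_onto (fun=> B).
  have [_ d _] := GP x; rewrite -(xB 0); exact: decidedS d.
- move=> U /choice [x xU]; have [t tU] := column_onto U.
  (* The fiber over [t] is not small, hence not covered by countably many initial segments with
     their endpoints; it contains a stage after all the [x n]. *)
  have [y [yt xy]] : exists y, column 0 y = t /\ forall n, lt (x n) y.
    apply: contrapT => H; apply: (@not_small_fiber0 t).
    apply: (@smallS _ _ (\bigcup_n ([set x n] `|` [set y | lt y (x n)]))).
      move=> y yt; apply: contrapT => N; apply: H; exists y; split=> // n.
      have [E|//|yx] := lt_total (x n) y; case: N; exists n => //.
        by left.
      by right.
    apply: small_bigcup => n; apply: small_setU => //.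
    by apply: small_subsingleton => a b -> ->.
  have [_ _ ok] := GP y; apply: OK_forS (FG y) _.
  have -> : U = column^~ t by apply/funext => n; rewrite tU.
  rewrite -yt; apply: ok => n; rewrite yt tU /=; right.
  by exists (x n).
Qed.

End construction.

Lemma exists_OK_filter : exists2 F, maximal_thick_filter F & OK_filter F.
Proof.
have [A [Am Al Ai]] := independent_linked_family.
have [lt [wf tr tot sm]] := small_well_order.
exact: (OK_filter_of_family Am Al Ai wf tr tot sm).
Qed.

(** * Left ideals and filters *)

Lemma ostar_sub (p q : ostar) : (forall A, p A -> q A) -> p = q.
Proof.
move=> pq; apply: ostar_eq => A; split; first exact: pq.
by move=> qA; apply: contrapT => /ostar_setC/pq/ostar_setC.
Qed.

Lemma ostar_ge (p : ostar) (N : nat) : p [set m | (N <= m)%N].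
Proof.
elim: N => [|N IH]; first by apply: filterS filterT.
have /ostar_setC pN : ~ p [set N].
  by have /(free_filterP (ufilter_ultra p)) := ufilter_free p; apply.
by apply: filterS (filterI IH pN) => m [/= Nm mN]; rewrite ltn_neqAle Nm andbT;
  apply/eqP => E; apply: mN.
Qed.

Lemma iter_shiftP (n : nat) (q : ostar) (A : set nat) :
  iter n shift q A <-> q [set m | A (m + n)%N].
Proof.
elim: n A => [|n IH] A /=.
  suff -> : [set m | A (m + 0)%N] = A by [].
  by apply/funext => m /=; rewrite addn0.
apply: (iff_trans (shift_filterP _ _)); apply: (iff_trans (IH _)).
suff -> : [set m | [set k | A k.+1] (m + n)%N] = [set m | A (m + n.+1)%N] by [].
by apply/funext => m /=; rewrite addnS.
Qed.

Lemma ostar_addP (p q : ostar) (A : set nat) :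
  (p + q)%ostar A <-> p [set n | q [set m | A (m + n)%N]].
Proof.
apply: (iff_trans (plimP _ _ _)).
suff -> : [set n | iter n shift q A] = [set n | q [set m | A (m + n)%N]] by [].
by apply/funext => n /=; apply/propext; exact: iter_shiftP.
Qed.

Lemma ostar_addA (p q r : ostar) : p + q + r = p + (q + r).
Proof.
apply: ostar_sub => A /ostar_addP/ostar_addP pA; apply/ostar_addP.
apply: filterS pA => k /= qA; apply/ostar_addP; apply: filterS qA => m /= rA.
by apply: filterS rA => l /=; rewrite addnA.
Qed.

Definition hull (F : set_system nat) : set ostar := [set p | F `<=` ufilter p].

Definition contains_cofinite (F : set_system nat) :=
  forall N, F [set m | (N <= m)%N].

Lemma hull_nonempty (F : set_system nat) :
  Filter F -> contains_cofinite F -> ~ F set0 -> hull F !=set0.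
Proof.
move=> FF Foo F0.
have [G [GU FG]] := @ultraFilterLemma _ F (Build_ProperFilter F0 FF).
suff Gf : free_filter G by exists (Ostar GU Gf).
apply/free_filterP => n Gn.
have /filter_ex [m [-> /=]] : G ([set n] `&` [set m | (n < m)%N]).
  by apply: filterI => //; exact/FG/Foo.
by rewrite ltnn.
Qed.

(** A filter for the closed set of [p] in [hull G] with [p + q = r]: by compactness, solving the
    equation amounts to showing that the filter is proper. *)
Definition solutions (G : set_system nat) (q r : ostar) : set_system nat :=
  [set X | exists A B,
    [/\ r A, G B & B `&` [set n | q [set m | A (m + n)%N]] `<=` X]].

Lemma solutions_filter (G : set_system nat) (q r : ostar) :
  Filter G -> Filter (solutions G q r).
Proof.
move=> GF; split.
- by exists setT, setT; split=> //; exact: filterT.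
- move=> X Y [A [B [rA GB ABX]]] [A' [B' [rA' GB' ABY]]].
  exists (A `&` A'), (B `&` B'); split; [exact: filterI|exact: filterI|].
  move=> n [[Bn B'n] qn]; split; [apply: ABX|apply: ABY]; split=> //;
    by apply: filterS qn => m [].
- move=> X Y XY [A [B [rA GB ABX]]]; exists A, B; split=> //.
  exact: subset_trans XY.
Qed.

Lemma sub_solutions (G : set_system nat) (q r : ostar) :
  G `<=` solutions G q r.
Proof.
by move=> B GB; exists setT, B; split=> [|//|m []//]; exact: filterT.
Qed.

Lemma hull_solutions (G : set_system nat) (p q r : ostar) : Filter G ->
  hull (solutions G q r) p <-> hull G p /\ p + q = r.
Proof.
move=> GF; split=> [Hp|[Gp pq] X [A [B [rA GB ABX]]]]; last first.
  apply: filterS ABX _; apply: filterI; first exact: Gp.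
  by apply/ostar_addP; rewrite pq.
split; first exact: (subset_trans (@sub_solutions _ _ _) Hp).
apply/esym/ostar_sub => A rA; apply/ostar_addP; apply: Hp.
by exists A, setT; split=> [//||m []//]; exact: filterT.
Qed.

Lemma add_solve (G : set_system nat) (q r : ostar) :
  Filter G -> contains_cofinite G ->
  (forall A B, r A -> G B -> exists2 n, B n & q [set m | A (m + n)%N]) ->
  exists2 p, hull G p & p + q = r.
Proof.
move=> GF Goo rG; have := solutions_filter q r GF => SF.
have [||p /(hull_solutions _ _ _ GF) []] := hull_nonempty SF.
- by move=> N; exact/sub_solutions/Goo.
- move=> [A [B [rA GB ABX]]]; have [n Bn qn] := rG _ _ rA GB.
  exact: (ABX n).
by exists p.
Qed.

Lemma Zorn_filter (F0 : set_system nat) (Q : set_system nat -> Prop) :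
  Filter F0 -> Q F0 ->
  (forall C : set (set_system nat), C !=set0 -> (forall G, C G -> Q G) ->
    Q [set A | exists2 G, C G & G A]) ->
  exists F, [/\ Filter F, F0 `<=` F, Q F &
    forall G, Filter G -> Q G -> F `<=` G -> G `<=` F].
Proof.
move=> FF0 QF0 Qcup.
pose P (S : set (set nat)) := S = set0 \/ [/\ Filter S, F0 `<=` S & Q S].
have [C CP Ctot|F [PF Fmax]] := @Zorn_bigcup _ P.
  have [[G [CG GF F0G QG]]|N] :=
      pselect (exists G, [/\ C G, Filter G, F0 `<=` G & Q G]); last first.
    left; rewrite -subset0 => A [G CG GA].
    have [G0|[GF F0G QG]] := CP G CG; first by rewrite G0 in GA.
    by apply: N; exists G.
  right; split.
  - split.
    + by exists G => //; exact: filterT.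
    + have CF S A : C S -> S A -> Filter S.
        by move=> CS SA; have [S0|[]//] := CP S CS; rewrite S0 in SA.
      move=> A B [S CS SA] [S' CS' S'B].
      have [SS'|S'S] := Ctot _ _ CS CS'.
        by have := CF _ _ CS' S'B => ?; exists S' => //; apply: filterI => //;
          exact: SS'.
      by have := CF _ _ CS SA => ?; exists S => //; apply: filterI => //;
        exact: S'S.
    + move=> A B AB [S CS SA]; exists S => //.
      have [S0|[SF _ _]] := CP S CS; first by rewrite S0 in SA.
      exact: filterS SA.
  - by move=> A F0A; exists G => //; exact: F0G.
  - have := Qcup [set S | C S /\ Q S].
    have -> : [set A | exists2 S, [set S | C S /\ Q S] S & S A] =
        \bigcup_(S in C) S.
      apply/seteqP; split=> A; first by move=> [S [CS _] SA]; exists S.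
      move=> [S CS SA]; exists S => //; split=> //.
      by have [S0|[]//] := CP S CS; rewrite S0 in SA.
    by apply; [exists G|move=> S []].
have [F0'|[FF F0F QF]] := PF.
  exfalso; apply: (Fmax F0); last by right; split.
  split; first by rewrite F0'.
  by move=> /(_ setT filterT); rewrite F0'.
exists F; split=> // G GF QG FG; apply: contrapT => GF'.
apply: (Fmax G); first by split.
by right; split=> //; exact: subset_trans FG.
Qed.

(* Ellis' lemma, for the closed subsemigroup [hull F]. *)
Lemma idempotent_in_hull (F : set_system nat) :
  Filter F -> contains_cofinite F -> ~ F set0 ->
  (forall p q, hull F p -> hull F q -> hull F (p + q)) ->
  exists2 q, hull F q & ostar_idempotent q.
Proof.
move=> FF Foo F0 FD.
have [||G [GF FG [G0 GD] Gmax]] := @Zorn_filter F (fun G => ~ G set0 /\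
    forall p q, hull G p -> hull G q -> hull G (p + q)) FF.
- by split.
- move=> C _ CP; split=> [[G /CP[]//]|p q pC qC A [G CG GA]].
  have [_ +] := CP G CG.
  by move=> /(_ p q); apply=> // B GB; [apply: pC|apply: qC]; exists G.
have Goo : contains_cofinite G by move=> N; exact/FG/Foo.
have [q Gq] := hull_nonempty GF Goo G0.
(* By maximality of [G], [hull G] is a minimal closed subsemigroup. [hull H] is [hull G + q],
   another one inside it, so it contains [q]. *)
pose H : set_system nat := [set A | forall p, hull G p -> (p + q)%ostar A].
have HF : Filter H.
  split=> [p _|A B HA HB p Gp|A B AB HA p Gp]; first exact: filterT.
    by apply: filterI; [exact: HA|exact: HB].
  by apply: filterS AB _; exact: HA.
have GH : G `<=` H by move=> A GA p Gp; exact: (GD p q Gp Gq).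
have hullH r : hull H r -> exists2 p, hull G p & p + q = r.
  move=> Hr; apply: add_solve => // A B rA GB; apply: contrapT => N.
  suff /Hr/ostar_setC : H (~` A) by [].
  move=> p Gp; apply/ostar_setC => /ostar_addP pA.
  have [n [Bn qn]] := filter_ex (filterI (Gp _ GB) pA).
  by apply: N; exists n.
have /hullH [p0 Gp0 p0q] : hull H q.
  apply: (subset_trans _ Gq); apply: Gmax => //; split.
    by move=> /(_ q Gq); exact: filter_not_empty.
  move=> r r' /hullH [p Gp <-] /hullH [p' Gp' <-] A HA.
  by rewrite -ostar_addA; apply: HA; apply: (GD _ _ (GD _ _ Gp Gq) Gp').
(* The [p] in [hull G] with [p + q = q] form a closed subsemigroup, nonempty by [p0]; by minimality
   [q] is one of them. *)
have sol p := hull_solutions p q q GF.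
have /sol [_ qq] : hull (solutions G q q) q; last first.
  by exists q => //; exact: subset_trans Gq.
apply: (subset_trans _ Gq); apply: Gmax; last exact: sub_solutions.
  exact: solutions_filter.
split=> [S0|p p' /sol [Gp pq] /sol [Gp' p'q]]; last first.
  by apply/sol; split; [exact: GD|rewrite ostar_addA p'q].
have /(_ _ S0) : hull (solutions G q q) p0 by apply/sol.
exact: filter_not_empty.
Qed.

Lemma ostar_interval (q : ostar) (A : set nat) (N : nat) :
  (forall n, (N <= n)%N -> q [set m | A (m + n)%N]) -> thick A.
Proof.
move=> qA k.
suff /filter_ex [m mA] : q [set m | forall i, (i < k)%N -> A (m + N + i)%N].
  by exists (m + N)%N.
elim: k => [|k IH]; first by apply: filterS filterT.
have := qA (N + k)%N (leq_addr _ _); move=> qk.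
apply: filterS (filterI IH qk) => m [mA mk] i.
rewrite ltnS leq_eqVlt => /orP[/eqP->|]; last exact: mA.
by rewrite -addnA.
Qed.

(** * The minimal left ideal of a maximal thick filter *)

Section maximal_thick_filter.
Variable F : set_system nat.
Hypothesis Fmax : maximal_thick_filter F.

Let FF : Filter F. Proof. by case: Fmax. Qed.

Lemma maximal_thick_mem B : (forall W, F W -> thick (W `&` B)) -> F B.
Proof.
move=> BF; have [_ _ /(_ B) [//|[W FW]]] := Fmax.
by case; exact: BF.
Qed.

Let Fthick U : F U -> thick U. Proof. by case: Fmax => _ + _; apply. Qed.

Lemma maximal_thick_cofinite : contains_cofinite F.
Proof.
by move=> N; apply: maximal_thick_mem => W /Fthick; exact: thick_ge.
Qed.

Lemma maximal_thick_proper : ~ F set0.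
Proof. by move=> /Fthick /(_ 1) [m /(_ 0 isT)]. Qed.

(** An interval of length [k.+1] inside both [A] and [W] yields one of length [k] inside [W] and the
    translate of [A]. *)
Lemma maximal_thick_succ A : F A -> F [set m | A m.+1].
Proof.
move=> FA; apply: maximal_thick_mem => W FW k.
have /Fthick /(_ k.+1) [m mP] : F (A `&` W) by exact: filterI.
exists m => i ik.
split; first by have [] := mP i (ltnW ik).
by rewrite /= -addnS; have [] := mP i.+1 ik.
Qed.

Lemma maximal_thick_pred A : F A -> F [set m | A m.-1].
Proof.
move=> FA; apply: maximal_thick_mem => W /maximal_thick_succ FW k.
have /Fthick /(_ k) [m mP] : F (A `&` [set m | W m.+1]) by exact: filterI.
exists m.+1 => i ik.
by rewrite addSn; have [] := mP i ik.
Qed.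

Lemma hull_shift q : hull F (shift q) <-> hull F q.
Proof.
split=> Fq A FA.
  by have /Fq/shift_filterP := maximal_thick_pred FA.
by apply/shift_filterP; exact/Fq/maximal_thick_succ.
Qed.

Lemma hull_iter_shift n q : hull F (iter n shift q) <-> hull F q.
Proof. by elim: n => //= n IH; apply: (iff_trans (hull_shift _)). Qed.

Lemma hull_add p q : hull F q -> hull F (p + q).
Proof.
move=> Fq A FA; apply/ostar_addP; apply: filterS filterT => n _ /=.
by apply/iter_shiftP; move/hull_iter_shift: Fq; apply.
Qed.

(** Suppose some [A] in [r] belonged to no shift of [q] from [N] on. Then each [W] in [F] and the
    complement of [A] would belong to all these shifts, hence meet in a thick set, and maximality
    would put the complement into [F] and so into [r]. *)
Lemma hull_solve q r : hull F q -> hull F r -> exists p, p + q = r.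
Proof.
move=> Fq Fr; suff [p _ pq] : exists2 p, hull \oo p & p + q = r by exists p.
apply: add_solve; first by move=> N; exists N.
move=> A B rA [N _ NB]; apply: contrapT => nB.
suff /Fr/ostar_setC : F (~` A) by [].
apply: maximal_thick_mem => W FW; apply: (@ostar_interval q _ N) => n Nn.
apply: (@filterS _ q _
    ([set m | W (m + n)%N] `&` [set m | (~` A) (m + n)%N])) => //.
apply: filterI; first by apply/iter_shiftP; move/hull_iter_shift: Fq; apply.
apply/ostar_setC => qn; apply: nB; exists n => //; exact: NB.
Qed.

Lemma hull_minimal_left_ideal : minimal_left_ideal (hull F).
Proof.
split.
  split; last by move=> p q; exact: hull_add.
  exact: (hull_nonempty FF maximal_thick_cofinite maximal_thick_proper).
move=> Z [[q Zq] ZD] ZF; apply/seteqP; split=> // r Fr.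
by have [p <-] := hull_solve (ZF _ Zq) Fr; exact: ZD.
Qed.

(* Each point of [D] lies in only finitely many of the [V a]. *)
Lemma OK_hull_weak_P : OK_filter F -> weak_P_set (hull F).
Proof.
move=> Fok D Dc DF.
have [d dP] := countable_sub_range Dc.
have /choice [U UP] n : exists U, F U /\ (D (d n) -> ~ d n U).
  have [Dn|Dn] := pselect (D (d n)); last first.
    by exists setT; split=> //; exact: filterT.
  have /existsNP [U /not_implyP [FU nU]] := DF _ Dn.
  by exists U.
have [V FV VP] := Fok U (fun n => (UP n).1).
have [a aP] : exists a, forall n, D (d n) -> ~ d n (V a).
  apply: contrapT => N.
  suff : small (\bigcup_n [set a | D (d n) /\ d n (V a)]).
    move=> /(_ id); apply=> a; exists a => //; apply: contrapT => na.
    apply: N; exists a => n Dn da; apply: na; exists n => //.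
  apply: small_bigcup => n; apply/small_countable/finite_set_countable.
  (* With [n.+1] indices the OK property reaches [U n] itself, so [d n] would contain [U n]. *)
  apply: contrapT => /(infinite_set_fset n.+1) [X XS nX].
  have {}XS b : b \in finmap.enum_fset X -> D (d n) /\ d n (V b) by exact: XS.
  have [M MP] := VP _ (finmap.fset_uniq X).
  move: (finmap.enum_fset X) XS nX MP => s sV ns MP.
  have Dn : D (d n).
    by case: s ns sV {MP} => // b s _ /(_ b (mem_head _ _)) [].
  apply: ((UP n).2 Dn).
  have dV : d n [set m | forall b, b \in s -> V b m].
    elim: s sV {ns MP} => [|b s IH] sV; first by apply: filterS filterT.
    have [_ db] := sV b (mem_head _ _).
    have {}IH : d n [set m | forall b, b \in s -> V b m].
      by apply: IH => b' b's; apply: sV; rewrite inE b's orbT.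
    apply: filterS (filterI db IH) => m [Vb Vs] b'.
    by rewrite inE => /orP[/eqP->//|]; exact: Vs.
  apply: filterS (filterI dV (ostar_ge (d n) M)) => m [Vm Mm].
  exact: (MP m Mm Vm n).
rewrite -subset0 => p [Dp Fp].
have [|r [Dr /= rV]] := Dp (basic (V a)).
  by apply/nbhs_ostarP; exists (V a) => //; exact/Fp/FV.
have [n _ nr] := dP _ Dr.
by apply: (aP n); rewrite nr.
Qed.

Lemma weak_P_hull_add p q :
  weak_P_set (hull F) -> hull F (p + q) <-> hull F q.
Proof.
move=> wP; split; last exact: hull_add.
move=> Fpq; apply: contrapT => nq.
have Dc : countable (range (fun n => iter n shift q)).
  exact: (@sub_countable _ _ _ [set: nat] (card_image_le _ _)).
have DF : range (fun n => iter n shift q) `<=` ~` hull F.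
  by move=> _ [n _ <-] /hull_iter_shift.
suff : (closure (range (fun n => iter n shift q)) `&` hull F) (p + q).
  by rewrite (wP _ Dc DF).
split=> // U /nbhs_ostarP [A /ostar_addP /filter_ex [n An] AU].
by exists (iter n shift q); split; [exists n|apply: AU; exact/iter_shiftP].
Qed.

Lemma idempotent_minimal q :
  hull F q -> ostar_idempotent q -> minimal_idempotent q.
Proof.
move=> Fq qq; split=> // p pp [pq qp].
have Fp : hull F p by rewrite -pq; exact: hull_add.
have [r rp] := hull_solve Fp Fq.
by rewrite -qp -rp ostar_addA pp.
Qed.

(** [q + p = q] forces [p] into [hull F] by the weak P-property; then [p = r + q] for some [r],
    whence [p + q = p]. *)
Lemma idempotent_leL_maximal q : weak_P_set (hull F) ->
  hull F q -> ostar_idempotent q -> leL_maximal q.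
Proof.
move=> wP Fq qq [p [pp qp]]; apply.
have Fp : hull F p by apply/(weak_P_hull_add q p wP); rewrite qp.
have [r <-] := hull_solve Fq Fp.
by rewrite /idem_leL ostar_addA qq.
Qed.

End maximal_thick_filter.

(** * A minimal left ideal that is not a weak P-set *)

Lemma maximal_thick_extension (F0 : set_system nat) :
  Filter F0 -> (forall U, F0 U -> thick U) ->
  exists2 F, maximal_thick_filter F & F0 `<=` F.
Proof.
move=> FF0 tF0.
have [|F [FF F0F tF Fmax]] :=
    @Zorn_filter F0 (fun F => forall U, F U -> thick U) FF0 tF0.
  by move=> C _ CP U [G /CP]; apply.
exists F => //; split=> // B.
have [tB|/existsNP [W /not_implyP [FW nW]]] :=
    pselect (forall W, F W -> thick (W `&` B)); last by right; exists W.
left; apply: (Fmax (adjoin F B)); [exact: adjoin_filter| |exact: sub_adjoin|].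
  by move=> X [W FW WX]; exact: thickS (tB W FW).
exact: adjoin_mem.
Qed.

(* Any minimal left ideal inside the orbit closure of a point outside it works;
   such a point is any ultrafilter containing the set of powers of 2. *)
Lemma not_weak_P_hull :
  exists2 F, maximal_thick_filter F & ~ weak_P_set (hull F).
Proof.
pose P : set nat := range (expn 2).
have [|||q qP] := @hull_nonempty (adjoin \oo P).
- exact: adjoin_filter.
- by move=> N; apply: sub_adjoin; exists N.
- move=> [U [N _ NU] UP]; apply: (UP (2 ^ N)); split; last by exists N.
  by apply: NU => /=; exact/ltnW/ltn_expl.
have {}qP : q P by apply: qP; exact: adjoin_mem.
(* The hull of [F0] is the set of cluster points of the sequence of shifts of [q]. *)
pose F0 : set_system nat :=
  [set A | exists N, forall n, (N <= n)%N -> q [set m | A (m + n)%N]].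
have [||F Fmax F0F] := @maximal_thick_extension F0.
- split.
  + by exists 0 => n _; exact: filterT.
  + move=> A B [N NA] [M MB]; exists (maxn N M) => n.
    rewrite geq_max => /andP[Nn Mn].
    by apply: filterS (filterI (NA n Nn) (MB n Mn)) => m [].
  + move=> A B AB [N NA]; exists N => n /NA; apply: filterS => m; exact: AB.
- by move=> A [N /ostar_interval].
exists F => // wP.
have nq : ~ hull F q.
  move=> Fq; suff /Fq/ostar_setC : F (~` P) by [].
  (* Starting at [1] omits [q] itself. Two powers of 2 at distance [n > 0], the smaller above [n],
     would satisfy [2 ^ a < 2 ^ b < 2 ^ a.+1]. *)
  apply: F0F; exists 1 => n n0; apply/ostar_setC => qn.
  have [m [[[a _ am] [b _ bm]] /= nm]] :=
    filter_ex (filterI (filterI qP qn) (ostar_ge q n.+1)).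
  have : (2 ^ a < 2 ^ b)%N by rewrite am bm -[ltnLHS]addn0 ltn_add2l.
  have : (2 ^ b < 2 ^ a.+1)%N by rewrite bm expnS am mul2n -addnn ltn_add2l.
  by rewrite !ltn_exp2l // ltnS => ba /(leq_trans)/(_ ba); rewrite ltnn.
have [r Fr] : hull F !=set0 by have [[]] := hull_minimal_left_ideal Fmax.
have Dc : countable (range (fun n => iter n shift q)).
  exact: (@sub_countable _ _ _ [set: nat] (card_image_le _ _)).
have DF : range (fun n => iter n shift q) `<=` ~` hull F.
  by move=> _ [n _ <-] /(hull_iter_shift Fmax).
suff : (closure (range (fun n => iter n shift q)) `&` hull F) r.
  by rewrite (wP _ Dc DF).
split=> // U /nbhs_ostarP [A rA AU]; apply: contrapT => N.
have /F0F/Fr/ostar_setC : F0 (~` A); last by [].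
exists 0 => n _; apply/ostar_setC => qn; apply: N.
by exists (iter n shift q); split; [exists n|apply: AU; exact/iter_shiftP].
Qed.

Lemma homeomorphism_weak_P (h : ostar -> ostar) (X : set ostar) :
  homeomorphism h -> weak_P_set X -> weak_P_set (h @` X).
Proof.
move=> [_ [g [hg gh gc]]] wX D Dc DX; rewrite -subset0 => r [Dr [x Xx xr]].
have gDc : countable (g @` D) by exact: sub_countable (card_image_le _ _) Dc.
have gDX : g @` D `<=` ~` X.
  by move=> _ [d Dd <-] Xd; apply: (DX _ Dd); exists (g d).
suff : (closure (g @` D) `&` X) x by rewrite (wX _ gDc gDX).
split=> // U xU; rewrite -xr in Dr.
have [|d [Dd Ud]] := Dr (g @^-1` U); first by apply: gc; rewrite hg.
by exists (g d); split=> //; exists d.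
Qed.

Theorem theorem6p2 :
  (exists L : set ostar, minimal_left_ideal L /\ weak_P_set L) /\
  [/\ exists q : ostar, minimal_idempotent q /\ leL_maximal q,
      exists L : set ostar, minimal_left_ideal L /\
        forall p q : ostar, L (p + q) <-> L q
    & exists L L' : set ostar,
        [/\ minimal_left_ideal L, minimal_left_ideal L' &
            ~ exists h : ostar -> ostar, homeomorphism h /\ h @` L = L']].
Proof.
have [F Fmax Fok] := exists_OK_filter.
have Lmin := hull_minimal_left_ideal Fmax.
have wP := OK_hull_weak_P Fmax Fok.
split; first by exists (hull F).
split.
- have [FF _ _] := Fmax.
  have [|||q Fq qq] := @idempotent_in_hull F FF.
  + exact: maximal_thick_cofinite.
  + exact: maximal_thick_proper.
  + by move=> p q _; exact: hull_add.
  exists q; split; first exact: idempotent_minimal Fq qq.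
  exact: idempotent_leL_maximal Fq qq.
- by exists (hull F); split=> // p q; exact: weak_P_hull_add.
- have [F' F'max nwP] := not_weak_P_hull.
  exists (hull F), (hull F'); split=> //; first exact: hull_minimal_left_ideal.
  by move=> [h [hh hL]]; apply: nwP; rewrite -hL; exact: homeomorphism_weak_P.
Qed.
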